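(* Let $k\geq 5$ be an integer. Suppose there exists an integer $m_0\geq 0$ such that $D_{k,m_0}(q)$ is unimodal and such that, for all integers $m$ with $m_0<m<8k^{3/2}$ and all integers $n$ with $\left\lceil\frac{k(k-1)m^2}{4}\right\rceil\leq n\leq\left\lfloor\frac{k(k-1)(m+1)^2}{4}\right\rfloor$, $$d_{k,m}(n)\geq d_{k,m}(n-1).$$ Then $D_{k,m}(q)$ is unimodal for every integer $m\geq m_0$.
   Context: For integers $k\geq 1$ and $m\geq 0$, put $$D_{k,m}(q)=\prod_{j=0}^m \left(1+q^{kj+1}\right)\left(1+q^{kj+2}\right)\cdots\left(1+q^{kj+k-1}\right)=\sum_{n=0}^{N(k,m)}d_{k,m}(n)q^n,\qquad N(k,m)=\frac{k(k-1)(m+1)^2}{2}.$$ Equivalently, $d_{k,m}(n)$ is the number of partitions of $n$ into distinct parts, none divisible by $k$, with largest part at most $km+k-1$. A polynomial $a_0+a_1q+\cdots+a_Nq^N$ with integer coefficients is called unimodal if for some $0\leq j\leq N$ one has $a_0\leq a_1\leq\cdots\leq a_j\geq a_{j+1}\geq\cdots\geq a_N$. *)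

(* Defs.v *)
From HB Require Import structures.
From mathcomp Require Import all_boot all_order all_algebra.
From mathcomp Require Import reals exp.
From mathcomp Require Import zify.

Set Implicit Arguments.
Unset Strict Implicit.
Unset Printing Implicit Defensive.

Import Order.TTheory GRing.Theory Num.Theory.
Local Open Scope ring_scope.

Definition D (k m : nat) : {poly int} :=
  \prod_(0 <= j < m.+1) \prod_(1 <= i < k) (1 + 'X^(k * j + i)).

Definition d (k m n : nat) : int := (D k m)`_n.

(* The top index N is the degree of p; for D k m with 0 < k this is
   k(k-1)(m+1)^2/2, see size_D. *)
Definition unimodal (p : {poly int}) : Prop :=
  exists j : nat,
    [/\ (j <= (size p).-1)%N,
        (forall i : nat, (i < j)%N -> p`_i <= p`_i.+1) &
        (forall i : nat, (j <= i < (size p).-1)%N -> p`_i.+1 <= p`_i)].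

Lemma size_D (k m : nat) : (0 < k)%N ->
  size (D k m) = ((k * k.-1 * m.+1 ^ 2) %/ 2).+1.
Proof.
case: k => // l _.
have szf (n : nat) : size (1 + 'X^(n.+1) : {poly int}) = n.+2.
  by rewrite addrC size_polyDl size_polyXn // size_poly1.
have inner (j r : nat) :
    (size (\prod_(1 <= i < r.+1) (1 + 'X^(l.+1 * j + i)) : {poly int})).*2 =
    (r * r.+1 + (l.+1 * j * r).*2).+2%N.
  elim: r => [|r IH]; first by rewrite big_geq // size_poly1 muln0.
  rewrite big_nat_recr //= addnS size_mul -?size_poly_eq0 ?szf //.
    by move: IH; set a := size _; nia.
  by apply/eqP => /= E; move: IH; rewrite E.
have outer : (size (D l.+1 m)).*2 = (l.+1 * l * m.+1 ^ 2).+2.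
  elim: m => [|m IH]; first by rewrite /D big_nat1 inner; lia.
  have Im := inner m.+1 l.
  rewrite /D big_nat_recr //= -/(D _ _) size_mul -?size_poly_eq0.
  - move: IH Im; set a := size _; set b := size _; nia.
  - by apply/eqP => E; move: IH; rewrite E.
  - by apply/eqP => E; move: Im; rewrite E.
by rewrite -[LHS]doubleK outer -divn2 /= -add2n divnDl // divnn.
Qed.

(* Main.v *)
Require Import Defs.
From HB Require Import structures.
From mathcomp Require Import all_boot all_order all_algebra.
From mathcomp Require Import reals exp.
From mathcomp Require Import topology normedtype sequences derive trigo.
From mathcomp Require Import ring lra zify.

(** Let [N] be the degree of [D k m], [C t = \prod_r cos (r t)] the product over
    the allowed parts [r] and [mu = N + 1 - 2 n]. Discrete Fourier inversion on a
    grid of [M > N] points of [[-pi/2, pi/2]] gives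
    [M (d n - d (n-1)) = 2 ^ (P + 1) * \sum_t C t * sin (mu t) * sin t],
    where [P] is the number of parts. If [s ^ 2] is of the order of the sum of the
    squares of the parts, the summand is at least [mu / (8 s ^ 2)] for [t] between
    [3 / (4 s)] and [2 / s], and it is never below [- mu / (32 s ^ 3)] when
    [m ^ 2 >= 64 k ^ 3]: where [sin (mu t)] may be negative, [C t] is tiny, by
    [cos x <= exp (- x ^ 2 / 2)] for small [t] and by
    [cos x ^ 2 <= exp (- sin x ^ 2)] with Dirichlet kernels for the other [t].
    Hence [d (n-1) <= d n] on the window of indices between the centres of
    [D k (m-1)] and [D k m]. Below the centre of [D k (m-1)] the coefficients of
    [D k m] increase because those of [D k (m-1)] do, and symmetry does the rest. *)

Set Implicit Arguments.
Unset Strict Implicit.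
Unset Printing Implicit Defensive.

Import Order.TTheory GRing.Theory Num.Theory.
Import numFieldNormedType.Exports.
Local Open Scope ring_scope.

(** * Elementary bounds for sine, cosine, the exponential and [pi] *)

Section RealBounds.
Variable R : realType.
Implicit Types x y t : R.

(** By the mean value theorem on [[0, x]]. In each Taylor bound below, the gap between the two sides
    has as derivative the gap of a bound one order lower, so the orders climb one by one. *)
Lemma ge0_of_derive_ge0 (f df : R -> R) x :
  (forall y, is_derive y 1 f (df y)) ->
  (forall y, 0 <= y <= x -> 0 <= df y) -> 0 <= f 0 -> 0 <= x -> 0 <= f x.
Proof.
move=> fdf df0 f0 x0.
have [|c + Ec] := @MVT_segment R f df 0 x x0 (fun y _ => fdf y).
  apply: continuous_subspaceT => y.
  exact/differentiable_continuous/derivable1_diffP/(@ex_derive _ _ _ _ _ _ _ (fdf y)).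
rewrite in_itv/= subr0 in Ec * => /andP[c0 cx].
have : 0 <= df c * x by rewrite mulr_ge0// df0// c0.
by rewrite -Ec; lra.
Qed.

Lemma sin_le x : 0 <= x -> sin x <= x.
Proof.
move=> x0; rewrite -subr_ge0.
apply: (@ge0_of_derive_ge0 (fun x => x - sin x) (fun x => 1 - cos x)) => //.
- by move=> y _; rewrite subr_ge0 cos_le1.
- by rewrite sin0 subr0.
Qed.

Lemma cos_ge_taylor2 x : 0 <= x -> 1 - x ^+ 2 / 2 <= cos x.
Proof.
move=> x0; rewrite -subr_ge0.
apply: (@ge0_of_derive_ge0 (fun x => cos x - (1 - x ^+ 2 / 2)) (fun x => x - sin x)) => //.
- move=> y; apply: is_derive_eq; rewrite /GRing.scale/=; lra.
- by move=> y /andP[y0 _]; rewrite subr_ge0 sin_le.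
- by rewrite cos0; lra.
Qed.

Lemma sin_ge_taylor3 x : 0 <= x -> x - x ^+ 3 / 6 <= sin x.
Proof.
move=> x0; rewrite -subr_ge0.
apply: (@ge0_of_derive_ge0 (fun x => sin x - (x - x ^+ 3 / 6))
  (fun x => cos x - (1 - x ^+ 2 / 2))) => //.
- move=> y; apply: is_derive_eq; rewrite /GRing.scale/=; lra.
- by move=> y /andP[y0 _]; rewrite subr_ge0 cos_ge_taylor2.
- by rewrite sin0; lra.
Qed.

Lemma cos_le_taylor4 x : 0 <= x -> cos x <= 1 - x ^+ 2 / 2 + x ^+ 4 / 24.
Proof.
move=> x0; rewrite -subr_ge0.
apply: (@ge0_of_derive_ge0 (fun x => 1 - x ^+ 2 / 2 + x ^+ 4 / 24 - cos x)
  (fun x => sin x - (x - x ^+ 3 / 6))) => //.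
- move=> y; apply: is_derive_eq; rewrite /GRing.scale/=; lra.
- by move=> y /andP[y0 _]; rewrite subr_ge0 sin_ge_taylor3.
- by rewrite cos0; lra.
Qed.

Lemma expRN_le_taylor2 x : 0 <= x -> expR (- x) <= 1 - x + x ^+ 2 / 2.
Proof.
move=> x0; rewrite -subr_ge0.
apply: (@ge0_of_derive_ge0 (fun x => 1 - x + x ^+ 2 / 2 - expR (- x))
  (fun x => expR (- x) - (1 - x))) => //.
- move=> y; apply: is_derive_eq; rewrite /GRing.scale/=; lra.
- by move=> y _; rewrite subr_ge0 expR_ge1Dx.
- by rewrite oppr0 expR0; lra.
Qed.

Lemma expRN_ge_taylor3 x : 0 <= x ->
  1 - x + x ^+ 2 / 2 - x ^+ 3 / 6 <= expR (- x).
Proof.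
move=> x0; rewrite -subr_ge0.
apply: (@ge0_of_derive_ge0
  (fun x => expR (- x) - (1 - x + x ^+ 2 / 2 - x ^+ 3 / 6))
  (fun x => 1 - x + x ^+ 2 / 2 - expR (- x))) => //.
- move=> y; apply: is_derive_eq; rewrite /GRing.scale/=; lra.
- by move=> y /andP[y0 _]; rewrite subr_ge0 expRN_le_taylor2.
- by rewrite oppr0 expR0; lra.
Qed.

Lemma cos_le_gauss x : 0 <= x <= 2 -> cos x <= expR (- (x ^+ 2 / 2)).
Proof.
move=> /andP[x0 x2]; apply: (le_trans (cos_le_taylor4 x0)).
have y0 : 0 <= x ^+ 2 / 2 by rewrite divr_ge0// sqr_ge0.
apply: le_trans (expRN_ge_taylor3 y0).
have x4 : x ^+ 2 <= 4 by nra.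
(* With [y = x ^ 2 / 2], the cubic bound for [exp (- y)] exceeds the quartic bound for [cos x] by
   [x ^ 4 * (4 - x ^ 2) / 48]. *)
have : 0 <= x ^+ 4 * (4 - x ^+ 2) by rewrite mulr_ge0 ?exprn_even_ge0// subr_ge0.
lra.
Qed.

(** From [sin u <= u] at [u = pi / 6]. The value [sin u = 1 / 2] comes from [0 = cos (3 u) = cos u *
    (1 - 4 * sin u ^ 2)]. *)
Lemma pi_ge3 : 3 <= pi :> R.
Proof.
set u : R := pi / 6.
have u0 : 0 < u by rewrite divr_gt0// pi_gt0.
have uhalf : u < pi / 2 by rewrite /u; have := pi_gt0 R; lra.
have cu : 0 < cos u by apply: cos_gt0_pihalf; rewrite uhalf andbT; lra.
have E : cos (u + (u + u)) = 0 by rewrite -(cos_pihalf R); congr cos; rewrite /u; lra.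
have su : sin u = 1 / 2.
  have s0 : 0 < sin u by apply: sin_gt0_pihalf; rewrite u0 uhalf.
  move: E; rewrite !cosD !sinD => E.
  have := cos2Dsin2 u; set c := cos u in E cu *; set s := sin u in E s0 * => E1.
  have : c * (1 - 4 * s ^+ 2) = 0.
    have -> : c * (1 - 4 * s ^+ 2) = c * (c ^+ 2 + s ^+ 2 - 4 * s ^+ 2) by rewrite E1.
    by rewrite -[RHS]E; ring.
  move/eqP; rewrite mulf_eq0 gt_eqF//= => /eqP E2.
  nra.
by have := sin_le (ltW u0); rewrite su /u; lra.
Qed.

Lemma abs_sin_natmul_le (n : nat) x : `|sin (n%:R * x)| <= n%:R * `|sin x|.
Proof.
elim: n => [|n IH]; first by rewrite !mul0r sin0 normr0.
rewrite -natr1 !mulrDl !mul1r sinD (le_trans (ler_normD _ _))// lerD//.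
- by rewrite normrM (le_trans _ IH)// ler_piMr// cos_max.
- by rewrite normrM ler_piMl// cos_max.
Qed.

Lemma abs_cos_le_expR x : `|cos x| <= expR (- (sin x ^+ 2 / 2)).
Proof.
rewrite -(@ler_pXn2r _ 2)// ?nnegrE ?expR_ge0//.
rewrite real_normK ?num_real// cos2sin2 -expRM_natl.
have -> : 2 * - (sin x ^+ 2 / 2) = - (sin x ^+ 2) by lra.
exact: expR_ge1Dx.
Qed.

Lemma sin_ge_mono x y : 0 <= x <= y -> y <= pi / 2 -> x - x ^+ 3 / 6 <= sin y.
Proof.
move=> /andP[x0 xy] yp; apply: (le_trans (sin_ge_taylor3 x0)).
have := pi_gt0 R => p0.
have [-> //|ne] := eqVneq x y.
rewrite ltW// ltr_sin ?in_itv/= ?lt_neqAle ?ne ?xy//; apply/andP; split; lra.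
Qed.

End RealBounds.

(** * Generating functions for distinct parts taken from a list *)

Definition distinct_gf (s : seq nat) : {poly int} := \prod_(r <- s) (1 + 'X^r).

Lemma distinct_gf_cons r s : distinct_gf (r :: s) = distinct_gf s * (1 + 'X^r).
Proof. by rewrite /distinct_gf big_cons mulrC. Qed.

Lemma coef_mul1DXn (p : {poly int}) r j :
  (p * (1 + 'X^r))`_j = p`_j + (if (j < r)%N then 0 else p`_(j - r)).
Proof. by rewrite mulrDr mulr1 coefD coefMXn. Qed.

Lemma distinct_gf_coef_gt s j : (sumn s < j)%N -> (distinct_gf s)`_j = 0.
Proof.
elim: s j => [|r s IH] j /=; first by rewrite /distinct_gf big_nil coef1; case: j.
move=> lt_j; rewrite distinct_gf_cons coef_mul1DXn IH; last lia.
by rewrite add0r; case: ifP => // _; apply: IH; lia.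
Qed.

(** Complementing the set of chosen parts; in the induction this swaps the cases of using and
    omitting [r]. *)
Lemma distinct_gf_sym s j : (j <= sumn s)%N ->
  (distinct_gf s)`_(sumn s - j) = (distinct_gf s)`_j.
Proof.
elim: s j => [|r s IH] j /= le_j; first by move: le_j; rewrite leqn0 => /eqP ->.
rewrite distinct_gf_cons !coef_mul1DXn [RHS]addrC; congr (_ + _).
- case: ltnP => h; first by rewrite distinct_gf_coef_gt//; lia.
  by rewrite -IH; [congr (_`_ _)|]; lia.
- case: ltnP => h; first by rewrite distinct_gf_coef_gt//; lia.
  by rewrite -[RHS]IH; [congr (_`_ _)|]; lia.
Qed.

(** * Discrete Fourier inversion for the coefficients *)

Section Fourier.
Variable R : realType.
Implicit Types (x y t : R) (s : seq nat).

(** The two values of [g] stand for omitting and using the part [r]. *)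
Lemma sum_coef_mul1DXn (p : {poly int}) (N r : nat) (g : nat -> R) :
  (forall j, (N < j)%N -> p`_j = 0) ->
  \sum_(j < (r + N).+1) ((p * (1 + 'X^r))`_j)%:~R * g j =
  \sum_(j < N.+1) (p`_j)%:~R * (g j + g (j + r)%N).
Proof.
move=> p0.
under eq_bigr => j _ do rewrite coef_mul1DXn rmorphD/= mulrDl.
under [RHS]eq_bigr => j _ do rewrite mulrDr.
rewrite !big_split/=; congr (_ + _).
- rewrite -addnS addnC big_split_ord/= [X in _ + X]big1 ?addr0// => i _.
  by rewrite p0 ?mul0r//=; lia.
- rewrite -addnS big_split_ord/= [X in X + _]big1 ?add0r => [|i _].
    apply: eq_bigr => i _; rewrite ltnNge leq_addr/= addKn.
    by rewrite addnC.
  by rewrite ltn_ord mul0r.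
Qed.

Definition cos_prod s t : R := \prod_(r <- s) cos (r%:R * t).

(** Real form of evaluating at [q = exp (2 i t)] and dividing by [exp (i N t)], [N] being the sum of
    the parts: each factor [1 + q ^ r] becomes [2 * cos (r t)]. The induction uses [cos (a - b) +
    cos (a + b) = 2 * cos a * cos b]. *)
Lemma distinct_gf_cos s t :
  \sum_(j < (sumn s).+1) ((distinct_gf s)`_j)%:~R * cos ((2 * j%:R - (sumn s)%:R) * t)
  = 2 ^+ size s * cos_prod s t.
Proof.
rewrite /cos_prod; elim: s => [|r s IH].
  by rewrite big_ord1 big_nil /distinct_gf big_nil coef1/= !mulr0 subrr mul0r cos0 !mulr1.
rewrite big_cons /= distinct_gf_cons.
rewrite (sum_coef_mul1DXn r (fun j => cos ((2 * j%:R - (r + sumn s)%:R) * t))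
  (@distinct_gf_coef_gt s)) exprS.
rewrite [RHS](_ : _ =
  2 * cos (r%:R * t) * (2 ^+ size s * \prod_(j <- s) cos (j%:R * t)))//; last by ring.
rewrite -IH mulr_sumr; apply: eq_bigr => j _.
rewrite !natrD.
set a := (2 * (j : nat)%:R - (sumn s)%:R) * t.
have -> : (2 * (j : nat)%:R - (r%:R + (sumn s)%:R)) * t = a - r%:R * t by rewrite /a; ring.
have -> : (2 * ((j : nat)%:R + r%:R) - (r%:R + (sumn s)%:R)) * t = a + r%:R * t by rewrite /a; ring.
by rewrite cosB cosD; ring.
Qed.

(** An interval of length [pi] is enough, since orthogonality is only needed for the even
    frequencies [2 * (i - j)]. *)
Definition grid (M a : nat) : R := pi * (a%:R / M%:R) - pi / 2.

Lemma sin_addMnpi2 x (n : nat) : sin (x + 2 * n%:R * pi) = sin x.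
Proof.
have -> : x + 2 * n%:R * pi = x + (pi *+ 2) *+ n :> R.
  by rewrite -[_ *+ n]mulr_natr -[pi *+ 2]mulr_natr; ring.
exact/periodicn/sinD2pi.
Qed.

(** Multiplied by [2 * sin h], with [h] half the increment of the argument, the sum telescopes; its
    two ends differ by the period [2 l pi], and [0 < l < M] makes [sin h] nonzero. *)
Lemma sum_cos_grid (M l : nat) : (0 < l < M)%N ->
  \sum_(a < M) cos (2 * l%:R * grid M a) = 0 :> R.
Proof.
move=> /andP[l0 lM].
have M0 : 0 < M%:R :> R by rewrite ltr0n; lia.
have MN : M%:R != 0 :> R by rewrite gt_eqF.
set h : R := l%:R * pi / M%:R.
have sh : 0 < sin h.
  have h0 : 0 < h by apply: divr_gt0 => //; apply: mulr_gt0; rewrite ?ltr0n ?pi_gt0.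
  apply: sin_gt0_pi; rewrite h0/= /h ltr_pdivrMr// mulrC ltr_pM2l ?pi_gt0//.
  by rewrite ltr_nat.
pose G (a : nat) := sin (2 * l%:R * grid M a - h).
have nz : 2 * sin h != 0 by apply: lt0r_neq0; apply: mulr_gt0.
apply: (mulfI nz).
rewrite mulr0 mulr_sumr.
have E (a : nat) : 2 * sin h * cos (2 * l%:R * grid M a) = G a.+1 - G a.
  rewrite /G.
  have -> : 2 * l%:R * grid M a.+1 - h = 2 * l%:R * grid M a + h.
    by rewrite /grid /h -natr1; move: pi => p; field.
  by rewrite sinB sinD; ring.
under eq_bigr => a _ do rewrite E.
rewrite -(big_mkord xpredT (fun a => G a.+1 - G a)) telescope_sumr// /G.
rewrite [X in sin X - _](_ : _ = 2 * l%:R * grid M 0 - h + 2 * l%:R * pi).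
  by rewrite sin_addMnpi2 subrr.
by rewrite /grid; move: pi => p; field.
Qed.

Lemma sum_cos_grid_sub (M i j : nat) : (i < M)%N -> (j < M)%N ->
  \sum_(a < M) cos (2 * (i%:R - j%:R) * grid M a) = (if i == j then M%:R else 0) :> R.
Proof.
move=> iM jM; case: ltngtP => [ij|ji|->].
- rewrite -[RHS](@sum_cos_grid M (j - i)); last lia.
  apply: eq_bigr => a _; rewrite -[RHS]cosN natrB 1?ltnW//; congr cos; ring.
- rewrite -[RHS](@sum_cos_grid M (i - j)); last lia.
  by apply: eq_bigr => a _; rewrite natrB 1?ltnW.
- under eq_bigr => a _ do rewrite subrr mulr0 mul0r cos0.
  by rewrite sumr_const card_ord.
Qed.

(** The product of two cosines splits into frequencies [2 (j - n)] and [2 (j - (N - n))].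
    Orthogonality retains [j = n] and [j = N - n], each with weight one half, and by symmetry the
    two coefficients agree. *)
Lemma distinct_gf_coef_grid s (M n : nat) : (sumn s < M)%N -> (n <= sumn s)%N ->
  \sum_(a < M) 2 ^+ size s * cos_prod s (grid M a)
     * cos ((2 * n%:R - (sumn s)%:R) * grid M a) = M%:R * ((distinct_gf s)`_n)%:~R.
Proof.
move=> NM nN; set N := sumn s in NM nN *.
pose c j : R := ((distinct_gf s)`_j)%:~R.
pose S (i j : nat) : R := \sum_(a < M) cos (2 * (i%:R - j%:R) * grid M a).
transitivity (\sum_(j < N.+1) c j / 2 * (S j n + S j (N - n)%N)).
  under eq_bigr => a _ do rewrite -distinct_gf_cos mulr_suml.
  rewrite exchange_big/=; apply: eq_bigr => j _.
  rewrite /S -big_split/= mulr_sumr; apply: eq_bigr => a _.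
  rewrite natrB//; set t := grid M a; rewrite -/N -/(c j).
  set x := (2 * (j : nat)%:R - N%:R) * t; set y := (2 * n%:R - N%:R) * t.
  have -> : 2 * ((j : nat)%:R - n%:R) * t = x - y by rewrite /x /y; ring.
  have -> : 2 * ((j : nat)%:R - (N%:R - n%:R)) * t = x + y by rewrite /x /y; ring.
  by rewrite cosB cosD; field.
have Sval (j : 'I_N.+1) i : (i <= N)%N -> S j i = if (j : nat) == i then M%:R else 0.
  by move=> iN; apply: sum_cos_grid_sub; have := ltn_ord j; lia.
have pick i : (i <= N)%N -> \sum_(j < N.+1) c j / 2 * S j i = c i / 2 * M%:R.
  move=> iN; rewrite (bigD1 (Ordinal (iN : (i < N.+1)%N)))//= big1 ?addr0.
    by rewrite (Sval (Ordinal (iN : (i < N.+1)%N)))//= eqxx.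
  move=> j /eqP ji; rewrite Sval//; case: eqP => [E|]; last by rewrite mulr0.
  by case: ji; apply: val_inj.
under eq_bigr => j _ do rewrite mulrDr.
rewrite big_split/= !pick ?leq_subr//.
by rewrite {2}/c distinct_gf_sym// -/(c n); field.
Qed.

(** The frequencies for [n] and [n - 1] are [1 - mu] and [- (1 + mu)], and [cos (t - mu t) - cos (t
    + mu t) = 2 * sin (mu t) * sin t]. *)
Lemma distinct_gf_diff_grid s (M n mu : nat) : (sumn s < M)%N -> (0 < n)%N ->
  (mu + 2 * n = (sumn s).+1)%N ->
  M%:R * ((distinct_gf s)`_n - (distinct_gf s)`_n.-1)%:~R =
  2 ^+ (size s).+1 * \sum_(a < M)
    cos_prod s (grid M a) * sin (mu%:R * grid M a) * sin (grid M a).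
Proof.
case: n => // n NM _ E; rewrite rmorphB/= mulrBr -!distinct_gf_coef_grid//; try lia.
rewrite -sumrB mulr_sumr; apply: eq_bigr => a _.
set t := grid M a.
have NE : (sumn s)%:R = mu%:R + 2 * n.+1%:R - 1 :> R.
  by rewrite -natrM -natrD E -natr1; ring.
have -> : (2 * n.+1%:R - (sumn s)%:R) * t = t - mu%:R * t by rewrite NE; ring.
have -> : (2 * n%:R - (sumn s)%:R) * t = - (t + mu%:R * t).
  by rewrite NE -[n.+1%:R]natr1; ring.
rewrite cosN cosB cosD exprS; ring.
Qed.

Lemma grid_bounds (M a : nat) : (a < M)%N -> - (pi / 2) <= grid M a <= pi / 2.
Proof.
move=> aM; have p0 := pi_gt0 R.
have M0 : 0 < M%:R :> R by rewrite ltr0n; lia.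
have q0 : 0 <= a%:R / M%:R :> R by rewrite divr_ge0.
have q1 : a%:R / M%:R <= 1 :> R by rewrite ler_pdivrMr// mul1r ler_nat ltnW.
rewrite /grid; apply/andP; split; nra.
Qed.

(* With [M = 4 s A] grid points, [A] of them are known to lie in [[3 / (4 s), 2 / s]],
   because [3 <= pi <= 4]: the gain [A * mu / (8 s^2)] equals the loss [M * mu / (32 s^3)]. *)
Lemma distinct_gf_diff_ge0 rs (n mu s : nat) : (0 < n)%N -> (0 < s)%N ->
  (mu + 2 * n = (sumn rs).+1)%N ->
  (forall t : R, 0 <= t <= pi / 2 ->
    - (mu%:R / (32 * s%:R ^+ 3)) <= cos_prod rs t * sin (mu%:R * t) * sin t) ->
  (forall t : R, 3 / (4 * s%:R) <= t <= 2 / s%:R ->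
    mu%:R / (8 * s%:R ^+ 2) <= cos_prod rs t * sin (mu%:R * t) * sin t) ->
  (distinct_gf rs)`_n.-1 <= (distinct_gf rs)`_n.
Proof.
move=> n0 s0 E tail main.
set A := (sumn rs).+1; pose M := (4 * s * A)%N.
have s0R : 0 < s%:R :> R by rewrite ltr0n.
have A0R : 0 < A%:R :> R by rewrite ltr0n.
have p3 := pi_ge3 R; have p4 := pihalf_lt2 R.
have NM : (sumn rs < M)%N by rewrite /M /A; nia.
have M0R : 0 < M%:R :> R by rewrite ltr0n; lia.
pose f t := cos_prod rs t * sin (mu%:R * t) * sin t.
have fN t : f (- t) = f t.
  rewrite /f mulrN !sinN [_ * - sin (_ * t)]mulrN mulrNN; congr (_ * _ * _).
  by apply: eq_bigr => r _; rewrite mulrN cosN.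
have Emu : 0 <= \sum_(a < M) f (grid M a).
  pose eps : R := mu%:R / (32 * s%:R ^+ 3); pose top : R := mu%:R / (8 * s%:R ^+ 2).
  (* Index [2 * s * A] is the grid point [0], so these [A] indices give points from [pi / (4 s)] up
     to [pi / (2 s)]. *)
  pose win (a : nat) := (2 * s * A + A <= a < 2 * s * A + 2 * A)%N.
  have eps0 : 0 <= eps by rewrite /eps divr_ge0// mulr_ge0// exprn_ge0// ltW.
  apply: (@le_trans _ _ (\sum_(a < M) ((if win a then top else 0) - eps))).
    rewrite sumrB sumr_const card_ord -big_mkcond/= -(big_mkord win (fun=> top)).
    rewrite (@big_cat_nat _ _ _ (2 * s * A + A))//=; last by rewrite /M; nia.
    rewrite big_nat_cond big_pred0 ?add0r; last first.
      by move=> a; rewrite /win; lia.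
    rewrite (@big_cat_nat _ _ _ (2 * s * A + 2 * A))//=; last 2 first.
    - by rewrite leq_add2l leq_pmull.
    - by rewrite /M; nia.
    rewrite [X in _ + X - _]big_nat_cond [X in _ + X - _]big_pred0; last first.
      by move=> a; rewrite /win; lia.
    rewrite big_nat_cond (eq_bigl (fun a => (2 * s * A + A <= a < 2 * s * A + 2 * A)%N && true)); last first.
      by move=> a; rewrite andbT /win andbb.
    rewrite -big_nat_cond sumr_const_nat addr0 subr_ge0.
    have -> : (2 * s * A + 2 * A - (2 * s * A + A) = A)%N by lia.
    rewrite -[eps *+ _]mulr_natr -[top *+ _]mulr_natr /eps /top /M !natrM le_eqVlt.
    by apply/orP; left; apply/eqP; field; rewrite gt_eqF.
  apply: ler_sum => a _.
  have tb := grid_bounds (ltn_ord a).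
  case: ifP => [/andP[wa wb]|_].
    suff : top <= f (grid M a) by lra.
    apply: main.
    have -> : grid M a = pi * ((a : nat)%:R - 2 * s%:R * A%:R) / (4 * s%:R * A%:R).
      by rewrite /grid /M !natrM; move: pi => p; field; rewrite !gt_eqF.
    set w := (a : nat)%:R - _.
    have wA : A%:R <= w by rewrite /w lerBrDr addrC -!natrM -natrD ler_nat.
    have wA2 : w <= 2 * A%:R.
      by rewrite /w lerBlDr addrC -!natrM -natrD ler_nat ltnW.
    have den : 0 < 4 * s%:R * A%:R :> R by rewrite !mulr_gt0.
    rewrite ler_pdivlMr// ler_pdivrMr//.
    have -> : 3 / (4 * s%:R) * (4 * s%:R * A%:R) = 3 * A%:R :> R by field; rewrite gt_eqF.
    have -> : 2 / s%:R * (4 * s%:R * A%:R) = 8 * A%:R :> R by field; rewrite gt_eqF.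
    apply/andP; split; nra.
  rewrite sub0r.
  have [t0|t0] := leP 0 (grid M a); first by apply: tail; rewrite t0; lra.
  by rewrite -fN; apply: tail; lra.
have := distinct_gf_diff_grid NM n0 E.
rewrite -/(f _) => Eq.
have : 0 <= M%:R * ((distinct_gf rs)`_n - (distinct_gf rs)`_n.-1)%:~R :> R.
  by rewrite Eq mulr_ge0 ?exprn_ge0.
by rewrite pmulr_rge0// ler0z subr_ge0.
Qed.

End Fourier.

(** * The list of allowed parts and sums over it *)

Definition parts (k m : nat) : seq nat :=
  [seq (k * j + i)%N | j <- index_iota 0 m.+1, i <- index_iota 1 k].

Lemma D_parts k m : D k m = distinct_gf (parts k m).
Proof. by rewrite /D /distinct_gf /parts big_allpairs_dep. Qed.

Lemma size_parts k m : size (parts k m) = (k.-1 * m.+1)%N.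
Proof. by rewrite size_allpairs !size_iota subn0 subn1 mulnC. Qed.

Lemma parts_le k m r : r \in parts k m -> (r < k * m.+1)%N.
Proof.
move=> /allpairsP[[j i]/=]; rewrite !mem_index_iota => -[jm ik ->].
by case/andP: ik => _ ik; case/andP: jm => _ jm; nia.
Qed.

(** The parts are the integers below [k (m + 1)] without the multiples of [k]; the index [0] lies in
    both sums and cancels. Sums over parts thus reduce to sums over full ranges, which have closed
    forms. *)
Lemma sum_parts (V : zmodType) (F : nat -> V) k m : (0 < k)%N ->
  \sum_(r <- parts k m) F r =
  \sum_(0 <= r < k * m.+1) F r - \sum_(0 <= j < m.+1) F (k * j)%N.
Proof.
move=> k0; rewrite big_allpairs_dep/=.
have block (j : nat) :
    \sum_(1 <= i < k) F (k * j + i)%N = \sum_(k * j <= r < k * j.+1) F r - F (k * j)%N.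
  have -> : \sum_(k * j <= r < k * j.+1) F r = \sum_(0 <= i < k) F (i + k * j)%N.
    by rewrite -{1}[(k * j)%N]add0n mulnS big_addn addnK.
  rewrite (big_ltn k0) add0n addrC addKr.
  by apply: eq_bigr => i _; rewrite addnC.
under eq_bigr => j _ do rewrite block.
rewrite sumrB; congr (_ - _).
elim: m => [|m IH]; first by rewrite big_nat1 muln0.
rewrite big_nat_recr//= IH -big_cat_nat//= leq_mul2l leqnSn orbT//.
Qed.

Lemma sumn_parts k m : (2 * sumn (parts k m) = k * k.-1 * m.+1 ^ 2)%N.
Proof.
case: k => [|k]; first by rewrite sumnE big_allpairs_dep/= big1// => j _; rewrite big_geq.
have inner (j r : nat) :
    (2 * \sum_(1 <= i < r.+1) (k.+1 * j + i) = r * r.+1 + 2 * (k.+1 * j * r))%N.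
  elim: r => [|r IH]; first by rewrite big_geq// !muln0.
  by rewrite big_nat_recr//= mulnDr IH; nia.
rewrite sumnE big_allpairs_dep; elim: m => [|m IH].
  by rewrite big_nat1 inner /=; lia.
by rewrite big_nat_recr//= mulnDr IH inner; nia.
Qed.

(** * Bounds for the cosine product, Dirichlet kernels and exponentials *)

Section CosProd.
Variable R : realType.
Implicit Types (t : R) (s : seq nat).

Definition sumsq s : R := \sum_(r <- s) r%:R ^+ 2.

Lemma sumsq_ge0 s : 0 <= sumsq s.
Proof. by apply: sumr_ge0 => r _; exact: sqr_ge0. Qed.

Lemma abs_cos_prod_le s t :
  `|cos_prod s t| <= expR (- ((\sum_(r <- s) sin (r%:R * t) ^+ 2) / 2)).
Proof.
rewrite /cos_prod normr_prod mulr_suml -sumrN expR_sum.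
by apply: ler_prod => r _; rewrite normr_ge0 abs_cos_le_expR.
Qed.

(** The bound [3 / 2] serves twice: it is at most [pi / 2], so every cosine is nonnegative, and at
    most [2], as [cos_le_gauss] asks. *)
Lemma cos_prod_le_gauss s t : 0 <= t -> {in s, forall r, r%:R * t <= 3 / 2} ->
  0 <= cos_prod s t <= expR (- (sumsq s * t ^+ 2 / 2)).
Proof.
move=> t0 st; have p3 := pi_ge3 R.
have x0 r : 0 <= r%:R * t by rewrite mulr_ge0.
rewrite /cos_prod /sumsq -mulrA mulr_suml -sumrN expR_sum.
have b r : r \in s -> 0 <= cos (r%:R * t) <= expR (- (r%:R ^+ 2 * (t ^+ 2 / 2))).
  move=> /st h; have h0 := x0 r; apply/andP; split.
    by apply: cos_ge0_pihalf; lra.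
  have := @cos_le_gauss R (r%:R * t); rewrite exprMn mulrA; apply; lra.
apply/andP; split; first by rewrite big_seq prodr_ge0// => r /b/andP[].
rewrite big_seq [leRHS]big_seq.
by apply: ler_prod => r /b.
Qed.

(** Weierstrass product inequality applied to the factors [1 - (r t) ^ 2 / 2]; the hypothesis keeps
    the quantities multiplied nonnegative. *)
Lemma cos_prod_ge s t : 0 <= t -> sumsq s * t ^+ 2 <= 1 ->
  1 - sumsq s * t ^+ 2 / 2 <= cos_prod s t.
Proof.
move=> t0; rewrite /sumsq /cos_prod; elim: s => [|r s IH].
  by rewrite !big_nil; lra.
rewrite !big_cons.
have S0 : 0 <= \sum_(j <- s) (j%:R : R) ^+ 2 by apply: sumr_ge0 => j _; rewrite sqr_ge0.
have := @cos_ge_taylor2 R (r%:R * t); rewrite mulr_ge0// exprMn => /(_ isT).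
move: IH S0; set S := \sum_(j <- s) _; set Q := \prod_(j <- s) _.
set c := cos _ => IH S0 hc h.
have t2 : 0 <= t ^+ 2 by exact: sqr_ge0.
have r2 : 0 <= (r%:R : R) ^+ 2 by exact: sqr_ge0.
have a0 : 0 <= S * t ^+ 2 by rewrite mulr_ge0.
have b0 : 0 <= r%:R ^+ 2 * t ^+ 2 by rewrite mulr_ge0.
have hQ : 1 - S * t ^+ 2 / 2 <= Q by apply: IH; lra.
have : (1 - r%:R ^+ 2 * t ^+ 2 / 2) * (1 - S * t ^+ 2 / 2) <= c * Q.
  by apply: ler_pM => //; lra.
by have := mulr_ge0 a0 b0; lra.
Qed.

Lemma sum_sqr (n : nat) :
  \sum_(0 <= r < n) (r%:R : R) ^+ 2 = n%:R * (n%:R - 1) * (2 * n%:R - 1) / 6.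
Proof.
elim: n => [|n IH]; first by rewrite big_geq// !mul0r.
by rewrite big_nat_recr//= IH -natr1; field.
Qed.

Lemma sumsq_parts k m : (0 < k)%N ->
  sumsq (parts k m) =
  k%:R * (k%:R - 1) * m.+1%:R * (2 * k%:R * m.+1%:R ^+ 2 - 1) / 6.
Proof.
move=> k0; rewrite /sumsq sum_parts// sum_sqr.
under eq_bigr => j _ do rewrite natrM exprMn.
by rewrite -mulr_sumr sum_sqr natrM; field.
Qed.

Lemma dirichlet (n : nat) t :
  2 * sin t * \sum_(0 <= r < n) cos (2 * r%:R * t) = sin ((2 * n%:R - 1) * t) + sin t.
Proof.
elim: n => [|n IH]; first by rewrite big_geq// !mulr0 sub0r mulN1r sinN addNr.
rewrite big_nat_recr//= mulrDr IH -[n.+1%:R]natr1.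
have -> : (2 * (n%:R + 1) - 1) * t = 2 * n%:R * t + t by ring.
have -> : (2 * n%:R - 1) * t = 2 * n%:R * t - t by ring.
by rewrite sinB sinD; ring.
Qed.

Lemma dirichlet_le (n : nat) t c : 0 < c <= sin t ->
  \sum_(0 <= r < n) cos (2 * r%:R * t) <= (c^-1 + 1) / 2.
Proof.
move=> /andP[c0 ct]; have s0 : 0 < sin t by exact: lt_le_trans ct.
have -> : \sum_(0 <= r < n) cos (2 * r%:R * t) = (sin ((2 * n%:R - 1) * t) / sin t + 1) / 2.
  apply: (@mulfI _ (2 * sin t)); first by rewrite mulf_neq0// gt_eqF.
  by rewrite dirichlet; field; rewrite gt_eqF.
suff : sin ((2 * n%:R - 1) * t) / sin t <= c^-1 by lra.
apply: (@le_trans _ _ (sin t)^-1).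
  by rewrite ler_piMl ?invr_ge0 ?sin_le1// ltW.
by rewrite lef_pV2.
Qed.

Lemma sum_cos_shift_pi (n : nat) (l : int) t :
  \sum_(0 <= r < n) cos (2 * r%:R * (t - l%:~R * pi)) =
  \sum_(0 <= r < n) cos (2 * r%:R * t).
Proof.
apply: eq_bigr => r _.
have cosDn x (j : nat) : cos (x + 2 * j%:R * pi) = cos x :> R.
  have -> : x + 2 * j%:R * pi = x + (pi *+ 2) *+ j :> R.
    by rewrite -[_ *+ j]mulr_natr -[pi *+ 2]mulr_natr; ring.
  exact/periodicn/cosD2pi.
case: l => l.
  rewrite -[LHS](cosDn _ (r * l)%N) natrM; congr cos.
  by rewrite -pmulrn; move: pi => p; ring.
rewrite -[RHS](cosDn _ (r * l.+1)%N) natrM; congr cos.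
by rewrite NegzE mulrNz -pmulrn; move: pi => p; ring.
Qed.

(* Modulo [pi] one may take |t| <= pi/2; the Dirichlet kernel is nonnegative up to
   [pi / (2n - 1)], and beyond that point [sin t >= 2 / (2n - 1)]. *)
Lemma dirichlet_ge (n : nat) t : (2 <= n)%N ->
  - (n%:R / 2) <= \sum_(0 <= r < n) cos (2 * r%:R * t).
Proof.
move=> n2; have p3 := pi_ge3 R; have p4 := pihalf_lt2 R; have p0 := pi_gt0 R.
have n2R : 2 <= n%:R :> R by rewrite ler_nat.
suff small (x : R) : 0 < x <= pi / 2 -> - (n%:R / 2) <= \sum_(0 <= r < n) cos (2 * r%:R * x).
  pose l := Num.floor (t / pi + 1 / 2).
  rewrite -(sum_cos_shift_pi n l); set y := t - _.
  have y_lo : - (pi / 2) <= y.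
    have : l%:~R * pi <= (t / pi + 1 / 2) * pi by rewrite ler_pM2r// floor_le_tmp.
    by rewrite mulrDl divfK ?gt_eqF// /y; lra.
  have y_hi : y <= pi / 2.
    have : (t / pi + 1 / 2) * pi <= (l + 1)%:~R * pi by rewrite ler_pM2r// ltW// floorD1_gt.
    by rewrite mulrDl divfK ?gt_eqF// rmorphD/= /y; lra.
  case: (ltgtP y 0) => y0.
  - have -> : \sum_(0 <= r < n) cos (2 * r%:R * y) = \sum_(0 <= r < n) cos (2 * r%:R * (- y)).
      by apply: eq_bigr => r _; rewrite mulrN cosN.
    by apply: small; lra.
  - by apply: small; lra.
  - rewrite y0; under eq_bigr => r _ do rewrite mulr0 cos0.
    by rewrite sumr_const_nat subn0; lra.
move=> /andP[x0 xp].
have s0 : 0 < sin x by apply: sin_gt0_pi; lra.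
have dk := dirichlet n x.
set S := \sum_(0 <= r < n) _ in dk *.
have [h|h] := leP ((2 * n%:R - 1) * x) pi.
  have : 0 <= sin ((2 * n%:R - 1) * x) by apply: sin_ge0_pi; nra.
  by nra.
set q : R := 2 * n%:R - 1 in dk h.
have q3 : 3 <= q by rewrite /q; lra.
(* Here [x > pi / q >= 3 / q], and [3 / q <= 1] makes the cubic term at most a sixth of [3 / q]; so
   [sin x >= 5 / (2 q)]. *)
have : 3 / q - (3 / q) ^+ 3 / 6 <= sin x.
  apply: sin_ge_mono => //; rewrite divr_ge0//=; last lra.
  by rewrite ler_pdivrMr; nra.
have u1 : 3 / q <= 1 by rewrite ler_pdivrMr; lra.
have u0 : 0 < 3 / q by rewrite divr_gt0//; lra.
have uq : 3 / q * q = 3 by rewrite divfK// gt_eqF//; lra.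
move: u1 u0 uq; set u := 3 / q => u1 u0 uq hs.
have {}hs : 5 / 6 * u <= sin x by nra.
have hs2 : 2 <= q * sin x by nra.
have := sin_geN1 (q * x).
have -> : n%:R = (q + 1) / 2 :> R by rewrite /q; lra.
by nra.
Qed.

(** [x ^ n * exp (- c x)] decreases from [x = n / c] on. No derivative is taken:
    [x / a <= exp (x / a - 1)] is raised to the power [n]. *)
Lemma pow_expR_decr (n : nat) (a c x : R) : 0 < a <= x -> n%:R <= c * a ->
  x ^+ n * expR (- (c * x)) <= a ^+ n * expR (- (c * a)).
Proof.
move=> /andP[a0 ax] nca.
have h : x <= a * expR ((x - a) / a).
  apply: (@le_trans _ _ (a * (1 + (x - a) / a))); last by rewrite ler_pM2l ?expR_ge1Dx.
  by rewrite le_eqVlt; apply/orP; left; apply/eqP; field; rewrite gt_eqF.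
apply: (@le_trans _ _ ((a * expR ((x - a) / a)) ^+ n * expR (- (c * x)))).
  by rewrite ler_pM2r ?expR_gt0// lerXn2r ?nnegrE ?mulr_ge0 ?expR_ge0//; lra.
rewrite exprMn -expRM_natl -mulrA -expRD ler_pM2l ?exprn_gt0// ler_expR.
have : n%:R * ((x - a) / a) <= c * (x - a).
  rewrite mulrCA mulrC ler_wpM2r ?subr_ge0// ler_pdivrMr//.
lra.
Qed.

(** The quadratic Taylor bound is too weak at [2]; at [1 / 4] it gives [25 / 32], whose eighth power
    is below [1 / 7]. *)
Lemma expRN2_le : expR (- 2) <= 7^-1 :> R.
Proof.
have -> : - 2 = 8%:R * - 4^-1 :> R by lra.
rewrite expRM_natl; have := @expRN_le_taylor2 R 4^-1; rewrite invr_ge0 ler0n => /(_ isT) h.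
apply: (@le_trans _ _ ((25 / 32) ^+ 8)); last by lra.
rewrite lerXn2r ?nnegrE ?expR_ge0//; lra.
Qed.

Lemma expRN_even_le (n : nat) (x : R) : 2 * n%:R <= x -> expR (- x) <= 7 ^- n.
Proof.
move=> h; rewrite -exprVn; apply: (@le_trans _ _ (expR (- 2) ^+ n)).
  by rewrite -expRM_natl ler_expR; lra.
by rewrite lerXn2r ?nnegrE ?expR_ge0 ?invr_ge0// expRN2_le.
Qed.

End CosProd.

(** * Estimates of the summand and monotonicity on the window for large [m] *)

Section Window.
Variable R : realType.
Implicit Types t : R.

Lemma sin_ge_linear (x : R) : 0 <= x <= 1 -> 5 / 6 * x <= sin x.
Proof.
move=> /andP[x0 x1]; apply: le_trans (sin_ge_taylor3 x0).
have h : 0 <= x * (1 - x ^+ 2) by rewrite mulr_ge0// subr_ge0 exprn_ile1.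
lra.
Qed.

Lemma le_of_sqr_le (a b : R) : 0 <= a -> 0 <= b -> a ^+ 2 <= b ^+ 2 -> a <= b.
Proof. by move=> a0 b0; rewrite ler_pXn2r. Qed.

(** Writing [sin ^ 2] as [(1 - cos) / 2] leaves a sum of cosines over the parts to bound from above:
    a Dirichlet kernel at [t], at most about [K / 3], minus one at [k t], at least [- (m + 1) / 2].
    The case [k = 5] leaves slightly more than the constant [1 / 9]. *)
Lemma cos_prod_far (k m : nat) t : (5 <= k)%N -> (90 <= m)%N -> t <= pi / 2 ->
  3 / 2 < (k%:R * m.+1%:R - 1) * t ->
  `|cos_prod (parts k m) t| <= expR (- (9^-1 * ((k%:R - 1) * m.+1%:R))).
Proof.
move=> k5 m90 tp Kt.
have kR : 5 <= k%:R :> R by rewrite ler_nat.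
have LR : 91 <= m.+1%:R :> R by rewrite ler_nat.
set L : R := m.+1%:R in LR Kt *; set K := k%:R * L - 1 in Kt *.
have K0 : 454 <= K by rewrite /K; nra.
have K00 : 0 < K by lra.
apply: (le_trans (abs_cos_prod_le _ _)); rewrite ler_expR lerN2.
suff : 2 * (9^-1 * ((k%:R - 1) * L)) <= \sum_(r <- parts k m) sin (r%:R * t) ^+ 2 by lra.
have -> : \sum_(r <- parts k m) sin (r%:R * t) ^+ 2 =
    ((k%:R - 1) * L - \sum_(r <- parts k m) cos (2 * r%:R * t)) / 2.
  transitivity (\sum_(r <- parts k m) (1 - cos (2 * r%:R * t)) / 2).
    apply: eq_bigr => r _.
    have -> : 2 * r%:R * t = (r%:R * t) *+ 2 by rewrite -[RHS]mulr_natl mulrA.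
    rewrite cos_mulr2n sin2cos2 -[_ *+ 2]mulr_natr.
    by field.
  rewrite -mulr_suml sumrB; congr ((_ - _) / _).
  rewrite big_const_seq count_predT size_parts iter_addr_0 natrM -subn1 natrB//.
  by lia.
rewrite sum_parts; last lia.
(* Passing from [3 / 2] to [149 / 100] absorbs the cubic Taylor term, as [K] is large. *)
have Sall : \sum_(0 <= r < k * m.+1) cos (2 * r%:R * t) <= ((149 / 100 / K)^-1 + 1) / 2.
  apply: dirichlet_le; apply/andP; split; first by apply: divr_gt0; lra.
  have u0 : 0 < K^-1 by rewrite invr_gt0.
  have u1 : K^-1 <= 1 / 100 by rewrite -div1r ler_pdivrMr//; lra.
  apply: (@le_trans _ _ (3 / 2 / K - (3 / 2 / K) ^+ 3 / 6)).
    have : (K^-1) ^+ 2 <= 1 / 10000 by nra.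
    move: u0; set u := K^-1 => u0 u2.
    have : 0 <= u * (1 / 10000 - u ^+ 2) by rewrite mulr_ge0 ?subr_ge0// ltW.
    lra.
  apply: sin_ge_mono => //; apply/andP; split; first by apply: divr_ge0; lra.
  by rewrite ler_pdivrMr// [t * K]mulrC ltW.
have Smult : - (L / 2) <= \sum_(0 <= j < m.+1) cos (2 * (k * j)%:R * t).
  have := @dirichlet_ge R m.+1 (k%:R * t); rewrite ltnS => /(_ _)/le_trans; apply; first by lia.
  rewrite le_eqVlt; apply/orP; left; apply/eqP; apply: eq_bigr => j _.
  by rewrite natrM; congr cos; ring.
have KE : (149 / 100 / K)^-1 = 100 / 149 * K by field; rewrite gt_eqF.
rewrite KE in Sall.
move: Sall Smult; set A := \sum_(0 <= r < _) _; set B := \sum_(0 <= r < _) _.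
rewrite /K => Sall Smult.
by nra.
Qed.

(** The factor [128 * (k L) ^ 5] dominates [32 s ^ 3] when [s ^ 3 <= 4 * (k L) ^ 5]. In terms of
    [P = (k - 1) L >= 4 * 91] the product decreases, so the end point [364] decides. *)
Lemma far_numeric (k L : R) : 5 <= k -> 91 <= L ->
  128 * (k * L) ^+ 5 * expR (- (9^-1 * ((k - 1) * L))) <= 1.
Proof.
move=> k5 L91; set P := (k - 1) * L.
have P364 : 364 <= P by rewrite /P; nra.
have kLP : k * L <= 5 / 4 * P by rewrite /P; nra.
have h : P ^+ 5 * expR (- (9^-1 * P)) <= 364 ^+ 5 * expR (- (9^-1 * 364)).
  by apply: pow_expR_decr; lra.
have e : expR (- (9^-1 * 364)) <= 7 ^- 20 :> R by apply: expRN_even_le; lra.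
have : (k * L) ^+ 5 <= (5 / 4 * P) ^+ 5 by rewrite lerXn2r ?nnegrE//; nra.
rewrite exprMn => kL5.
have e0 := expR_gt0 (- (9^-1 * P)).
apply: (@le_trans _ _ (128 * ((5 / 4) ^+ 5 * P ^+ 5) * expR (- (9^-1 * P)))).
  by apply: ler_wpM2r; lra.
by lra.
Qed.

(** With [z = L / (k - 1)], the hypothesis [64 k ^ 3 <= L ^ 2] gives [64 k <= z ^ 2] and
    [64 L <= z ^ 3], hence [16 ^ 3 * k L <= z ^ 5]. What remains is a multiple of
    [z ^ 15 * exp (- 7 z / 5)], decreasing for [z >= 22]. *)
Lemma mid_numeric (k L : R) : 5 <= k -> 91 <= L -> 22 * (k - 1) <= L ->
  64 * k ^+ 3 <= L ^+ 2 ->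
  128 * (k * L) ^+ 5 * (9 / 4 / (k * L - 1) ^+ 2 * expR (- (7 / 5 * (L / (k - 1))))) <= 1.
Proof.
move=> k5 L91 kL k3.
set y := k * L; set z := L / (k - 1).
have y0 : 455 <= y by rewrite /y; nra.
have z22 : 22 <= z by rewrite /z ler_pdivlMr; lra.
have Lz : L = z * (k - 1) by rewrite /z divfK// gt_eqF//; lra.
have Lzk : L <= z * k by rewrite Lz; nra.
have kz : 64 * k <= z ^+ 2.
  have : L ^+ 2 <= (z * k) ^+ 2 by rewrite lerXn2r ?nnegrE//; nra.
  move=> h; have : k ^+ 2 * (64 * k) <= k ^+ 2 * z ^+ 2 by move: h; rewrite exprMn; lra.
  by rewrite ler_pM2l ?exprn_gt0//; lra.
have Lz3 : 64 * L <= z ^+ 3 by rewrite exprSr; nra.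
have yz : y * 16 ^+ 3 <= z ^+ 5.
  have -> : y * 16 ^+ 3 = (64 * k) * (64 * L) by rewrite /y; ring.
  have -> : z ^+ 5 = z ^+ 2 * z ^+ 3 by ring.
  by apply: ler_pM => //; lra.
have y3 : (y * 16 ^+ 3) ^+ 3 <= (z ^+ 5) ^+ 3 by rewrite lerXn2r ?nnegrE//; lra.
have e : z ^+ 15 * expR (- (7 / 5 * z)) <= 22 ^+ 15 * expR (- (7 / 5 * 22)).
  by apply: pow_expR_decr; lra.
have e2 : expR (- (7 / 5 * 22)) <= 7 ^- 15 :> R by apply: expRN_even_le; lra.
have q : y ^+ 2 / (y - 1) ^+ 2 <= 101 / 100 by rewrite ler_pdivrMr ?exprn_gt0//; nra.
have e0 := expR_gt0 (- (7 / 5 * z)).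
have -> : 128 * y ^+ 5 * (9 / 4 / (y - 1) ^+ 2 * expR (- (7 / 5 * z))) =
  288 * (y ^+ 2 / (y - 1) ^+ 2) * (y ^+ 3 * expR (- (7 / 5 * z))).
  by field; rewrite gt_eqF//; lra.
have b0 : 0 <= y ^+ 3 * expR (- (7 / 5 * z)).
  by rewrite mulr_ge0// ?exprn_ge0//; lra.
apply: (@le_trans _ _ (291 * (y ^+ 3 * expR (- (7 / 5 * z))))).
  by rewrite ler_wpM2r//; lra.
have : y ^+ 3 * 16 ^+ 9 * expR (- (7 / 5 * z)) <= z ^+ 15 * expR (- (7 / 5 * z)).
  rewrite ler_pM2r//; move: y3; rewrite exprMn -!exprM; lra.
lra.
Qed.

(** The scale [s] must be an integer because it enters the number of grid points. *)
Lemma nat_sqrt_approx (X : nat) : (4 <= X)%N -> exists s, (X <= s ^ 2 <= 2 * X)%N.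
Proof.
move=> X4; have ex : exists s, (X <= s ^ 2)%N by exists X; nia.
case: (ex_minnP ex) => s hs min; exists s; rewrite hs/=.
case: s hs min => [|s] hs min; first by lia.
have : (s ^ 2 < X)%N by rewrite ltnNge; apply/negP => /min; lia.
by nia.
Qed.

(** The cosine product is at least [1 / 2], and each sine is at least [5 / 6] of its argument,
    itself at least [3 / 4] of [1 / sg] or [u / sg]. This gives
    [1 / 2 * (5 / 8) ^ 2 = 25 / 128 >= 1 / 8]. *)
Lemma cos_prod_main s t (u sg : R) : 0 <= u -> 4 <= sg -> 2 * u <= sg ->
  4 * sumsq R s <= sg ^+ 2 -> 3 / (4 * sg) <= t <= 2 / sg ->
  u / (8 * sg ^+ 2) <= cos_prod s t * sin (u * t) * sin t.
Proof.
move=> u0 sg4 u_sg s_sg /andP[t_lo t_hi].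
have sg0 : 0 < sg by lra.
have sv0 : 0 < sg^-1 by rewrite invr_gt0.
have -> : u / (8 * sg ^+ 2) = 1 / 8 * (u * sg^-1) * sg^-1 by field; rewrite gt_eqF.
have {}t_lo : 3 / 4 * sg^-1 <= t.
  by move: t_lo; have -> : 3 / (4 * sg) = 3 / 4 * sg^-1 by field; rewrite gt_eqF.
have t0 : 0 <= t by lra.
have t1 : t <= 1 by apply: (le_trans t_hi); rewrite ler_pdivrMr//; lra.
have ut1 : u * t <= 1.
  apply: (@le_trans _ _ (u * (2 / sg))); first by rewrite ler_wpM2l.
  by rewrite mulrA ler_pdivrMr//; lra.
have C1 : 1 / 2 <= cos_prod s t.
  have h : sumsq R s * t ^+ 2 <= 1.
    have -> : 1 = sg ^+ 2 / 4 * (2 / sg) ^+ 2 by field; rewrite gt_eqF.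
    apply: ler_pM; [exact: sumsq_ge0|exact: sqr_ge0|lra|].
    by rewrite lerXn2r// nnegrE divr_ge0// ltW.
  by have := cos_prod_ge t0 h; lra.
have h1 : 5 / 8 * sg^-1 <= sin t.
  by apply: (@le_trans _ _ (5 / 6 * t)); [lra|apply: sin_ge_linear; lra].
have us : 0 <= u * sg^-1 by rewrite mulr_ge0// ltW.
have h2 : 5 / 8 * (u * sg^-1) <= sin (u * t).
  apply: (@le_trans _ _ (5 / 6 * (u * t))).
    by have := ler_wpM2l u0 t_lo; lra.
  by apply: sin_ge_linear; rewrite ut1 mulr_ge0.
apply: (@le_trans _ _ (1 / 2 * (5 / 8 * (u * sg^-1)) * (5 / 8 * sg^-1))).
  by have := mulr_ge0 us (ltW sv0); lra.
have e1 : 0 <= 5 / 8 * (u * sg^-1) by lra.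
apply: ler_pM => //; [lra|lra|].
by apply: ler_pM => //; lra.
Qed.

(** The hypotheses force [t >= 3 / (k (k - 1) L)] with [L = m + 1], and the sum of squares is about
    [k ^ 2 (k - 1) L ^ 3 / 3]; the exponent is then about [3 / 2 * L / (k - 1)]. Taking [7 / 5]
    absorbs the lower order term. *)
Lemma gauss_exponent_ge (k m : nat) t (u : R) : (5 <= k)%N -> (90 <= m)%N ->
  0 <= t -> 3 <= u * t -> u <= k%:R * (k%:R - 1) * m.+1%:R ->
  7 / 5 * (m.+1%:R / (k%:R - 1)) <= sumsq R (parts k m) * t ^+ 2 / 2.
Proof.
move=> k5 m90 t0 ut u_hi.
have kR : 5 <= k%:R :> R by rewrite ler_nat.
have LR : 91 <= m.+1%:R :> R by rewrite ler_nat.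
have S0 := @sumsq_ge0 R (parts k m).
have SE := @sumsq_parts R k m (ltn_trans (isT : 0 < 4)%N k5).
move: u_hi kR LR SE; set kk : R := k%:R; set l : R := m.+1%:R.
move=> u_hi kR LR SE; set v := kk * (kk - 1) * l in u_hi *.
have v0 : 0 < v by rewrite /v mulr_gt0 ?mulr_gt0//; lra.
have vt : 3 <= v * t by apply: (le_trans ut); rewrite ler_wpM2r.
have ht : 9 / v ^+ 2 <= t ^+ 2.
  rewrite ler_pdivrMr ?exprn_gt0// mulrC -exprMn.
  have -> : 9 = 3 ^+ 2 :> R by lra.
  by rewrite lerXn2r ?nnegrE//; lra.
apply: (@le_trans _ _ (sumsq R (parts k m) * (9 / v ^+ 2) / 2)); last first.
  by apply: ler_wpM2r; [rewrite invr_ge0|exact: ler_wpM2l].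
rewrite SE -subr_ge0 /v.
have -> : kk * (kk - 1) * l * (2 * kk * l ^+ 2 - 1) / 6 *
    (9 / (kk * (kk - 1) * l) ^+ 2) / 2 - 7 / 5 * (l / (kk - 1)) =
    (1 / 10 * (kk * l ^+ 2) - 3 / 4) / (kk * (kk - 1) * l).
  have n1 : kk - 1 != 0 by rewrite gt_eqF//; lra.
  have n2 : kk != 0 by rewrite gt_eqF//; lra.
  have n3 : l != 0 by rewrite gt_eqF//; lra.
  by clear -n1 n2 n3; clearbody kk l; field; rewrite n1 n2 n3.
have : 5 * 91 <= kk * l ^+ 2 by apply: ler_pM => //; nra.
by move=> ?; apply: divr_ge0; [lra|exact: ltW].
Qed.

(** Three ranges, where [K = k (m + 1) - 1] bounds every part. For [K t > 3 / 2] the product is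
    tiny. Otherwise it is nonnegative: if [mu t <= pi] so is the whole summand, and if [mu t > pi]
    the Gaussian bound is combined with [|sin (mu t) * sin t| <= mu t ^ 2]. *)
Lemma cos_prod_tail (k m mu : nat) t (sg : R) : (5 <= k)%N -> (90 <= m)%N ->
  (22 * k.-1 <= m)%N -> (64 * k ^ 3 <= m ^ 2)%N -> 0 < sg ->
  sg ^+ 3 <= 4 * (k%:R * m.+1%:R) ^+ 5 -> (mu <= k * k.-1 * m.+1)%N ->
  0 <= t <= pi / 2 ->
  - (mu%:R / (32 * sg ^+ 3)) <= cos_prod (parts k m) t * sin (mu%:R * t) * sin t.
Proof.
move=> k5 m90 k22 km sg0 sg3 mu_hi /andP[t0 tp].
have p3 := pi_ge3 R.
have kR : 5 <= k%:R :> R by rewrite ler_nat.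
have LR : 91 <= m.+1%:R :> R by rewrite ler_nat.
have k1R : k.-1%:R = k%:R - 1 :> R by rewrite -subn1 natrB//; lia.
have k22R : 22 * (k%:R - 1) <= m.+1%:R :> R.
  by rewrite -k1R -natrM ler_nat; lia.
have k3R : 64 * k%:R ^+ 3 <= m.+1%:R ^+ 2 :> R.
  by rewrite -!natrX -natrM ler_nat (leq_trans km)// leq_exp2r.
have muR : mu%:R <= k%:R * (k%:R - 1) * m.+1%:R :> R by rewrite -k1R -!natrM ler_nat.
have partsR r : r \in parts k m -> (r%:R : R) <= k%:R * m.+1%:R - 1.
  by move=> /parts_le h; rewrite lerBrDr natr1 -natrM ler_nat.
have far_num := far_numeric kR LR.
have mid_num := mid_numeric kR LR k22R k3R.
have K0 : 0 < k%:R * m.+1%:R - 1 :> R by nra.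
have s3p : 0 < 32 * sg ^+ 3 by rewrite mulr_gt0// exprn_gt0.
have st0 : 0 <= sin t by apply: sin_ge0_pi; lra.
have st1 : sin t <= t by exact: sin_le.
have mu0 : 0 <= mu%:R :> R by [].
have s3 : 32 * sg ^+ 3 <= 128 * (k%:R * m.+1%:R) ^+ 5 by lra.
set K := k%:R * m.+1%:R - 1 in partsR mid_num K0.
set C := cos_prod _ t; set u : R := mu%:R in muR mu0 *.
have [Kt|Kt] := leP (K * t) (3 / 2); last first.
  have Cb : `|C| <= (32 * sg ^+ 3)^-1.
    apply: (le_trans (cos_prod_far k5 m90 tp Kt)).
    rewrite -[leRHS]div1r ler_pdivlMr// [leLHS]mulrC.
    by apply: le_trans far_num; rewrite ler_wpM2r ?expR_ge0.
  suff : `|C * sin (u * t) * sin t| <= u / (32 * sg ^+ 3).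
    by rewrite ler_norml => /andP[].
  rewrite -mulrA normrM mulrC; apply: ler_pM => //.
  rewrite normrM (@le_trans _ _ `|sin (u * t)|)//; first by rewrite ler_piMr// sin_max.
  by rewrite (le_trans (abs_sin_natmul_le _ _))// ler_piMr// sin_max.
have /andP[C0 C1] : 0 <= C <= expR (- (sumsq R (parts k m) * t ^+ 2 / 2)).
  apply: cos_prod_le_gauss => // r /partsR h.
  by apply: le_trans Kt; rewrite ler_wpM2r.
have [ut|ut] := leP (u * t) pi.
  apply: (@le_trans _ _ 0); first by rewrite oppr_le0 divr_ge0// ltW.
  by rewrite !mulr_ge0//; apply: sin_ge0_pi; rewrite ut mulr_ge0.
have tt : t ^+ 2 <= 9 / 4 / K ^+ 2.
  rewrite ler_pdivlMr ?exprn_gt0// mulrC -exprMn.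
  have -> : 9 / 4 = (3 / 2) ^+ 2 :> R by lra.
  by rewrite lerXn2r ?nnegrE ?mulr_ge0// ?ltW//; lra.
have C2 : C <= expR (- (7 / 5 * (m.+1%:R / (k%:R - 1)))).
  apply: (le_trans C1); rewrite ler_expR lerN2.
  by apply: gauss_exponent_ge muR => //; lra.
have Ct : 32 * sg ^+ 3 * (t ^+ 2 * C) <= 1.
  apply: le_trans mid_num; apply: ler_pM => //; first exact: ltW.
  - by rewrite mulr_ge0// sqr_ge0.
  - by apply: ler_pM => //; exact: sqr_ge0.
have : u * (t ^+ 2 * C) <= u / (32 * sg ^+ 3).
  by rewrite ler_wpM2l// -[leRHS]div1r ler_pdivlMr// mulrC.
have : - (u * t ^+ 2) <= sin (u * t) * sin t.
  have := abs_sin_natmul_le mu t; rewrite -/u (ger0_norm st0) ler_norml => /andP[tl _].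
  have h1 : - (u * sin t) * sin t <= sin (u * t) * sin t by rewrite ler_wpM2r.
  have h2 : u * (sin t * sin t) <= u * (t * t) by rewrite ler_wpM2l// ler_pM.
  lra.
move/(ler_wpM2l C0).
lra.
Qed.

Lemma window_diff_large (k m n : nat) : (5 <= k)%N -> (64 * k ^ 3 <= m ^ 2)%N ->
  (k * k.-1 * m ^ 2 <= 4 * n)%N -> (4 * n <= k * k.-1 * m.+1 ^ 2)%N ->
  d k m n.-1 <= d k m n.
Proof.
move=> k5 km n_lo n_hi; rewrite /d D_parts.
have N2 := sumn_parts k m.
have k3 : (125 <= k ^ 3)%N by rewrite (@leq_exp2r 5 k 3).
have m90 : (90 <= m)%N by nia.
have n0 : (0 < n)%N by nia.
(* [(22 (k - 1)) ^ 2 <= 64 k ^ 3] holds from [k = 5] on, where it reads [7744 <= 8000]. *)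
have k22 : (22 * k.-1 <= m)%N.
  rewrite -(@leq_exp2r _ _ 2)// (leq_trans _ km)//.
  by case: k k5 {km k3 n_lo n_hi N2} => // k k5 /=; nia.
set N := sumn (parts k m) in N2.
have [mu Emu] : exists mu, (mu + 2 * n = N.+1)%N by exists (N.+1 - 2 * n)%N; lia.
(* The lower end of the window gives [2 mu <= k (k - 1) (2 m + 1) + 2]. *)
have mu_hi : (mu <= k * k.-1 * m.+1)%N by nia.
(* [X] is six times the leading term of the sum of squares. Then [X <= s ^ 2] provides what the main
   range asks of [s], and [s ^ 2 <= 2 X] yields [s ^ 3 <= 4 * (k (m + 1)) ^ 5] for the tail. *)
pose X := (2 * (k ^ 2 * k.-1 * m.+1 ^ 3))%N.
have X4 : (4 <= X)%N.
  rewrite /X (@leq_pmul2l 2 2)// (@leq_trans (1 * 1 * 2 ^ 3))//.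
  by rewrite leq_mul ?leq_mul ?leq_exp2r ?expn_gt0//; lia.
have [s /andP[s_lo s_hi]] := nat_sqrt_approx X4.
have s0 : (0 < s)%N by case: (s) s_lo => //; lia.
have kR : 5 <= k%:R :> R by rewrite ler_nat.
have LR : 91 <= m.+1%:R :> R by rewrite ler_nat.
have k1R : k.-1%:R = k%:R - 1 :> R by rewrite -subn1 natrB//; lia.
have k22R : 22 * (k%:R - 1) <= m.+1%:R :> R by rewrite -k1R -natrM ler_nat; lia.
have sR : 0 < s%:R :> R by rewrite ltr0n.
have s_loR : 2 * (k%:R ^+ 2 * (k%:R - 1) * m.+1%:R ^+ 3) <= s%:R ^+ 2 :> R.
  by rewrite -k1R -!natrX -!natrM ler_nat.
have s_hiR : s%:R ^+ 2 <= 4 * (k%:R ^+ 2 * (k%:R - 1) * m.+1%:R ^+ 3) :> R.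
  by rewrite -k1R -!natrX -!natrM ler_nat (leq_trans s_hi)// /X; lia.
have muR : mu%:R <= k%:R * (k%:R - 1) * m.+1%:R :> R by rewrite -k1R -!natrM ler_nat.
have SE := @sumsq_parts R k m (ltn_trans (isT : 0 < 4)%N k5).
apply: (@distinct_gf_diff_ge0 R _ n mu s) => // t; last first.
  apply: cos_prod_main => //.
  - move: s_loR kR k22R LR sR; clear; set a := k%:R; set l := m.+1%:R => s_loR kR k22R LR sR.
    apply: le_of_sqr_le; [lra|lra|]; apply: le_trans s_loR.
    have : 5 ^+ 2 * 4 * 1 ^+ 3 <= a ^+ 2 * (a - 1) * l ^+ 3.
      by rewrite !ler_pM ?lerXn2r ?nnegrE ?mulr_ge0//; lra.
    lra.
  - have mu0 : 0 <= mu%:R :> R by [].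
    move: s_loR muR kR k22R LR sR mu0; clear.
    set a := k%:R; set l := m.+1%:R; set u := mu%:R => s_loR muR kR k22R LR sR u0.
    apply: le_of_sqr_le; [lra|lra|]; apply: le_trans s_loR.
    apply: (@le_trans _ _ ((2 * (a * (a - 1) * l)) ^+ 2)).
      by rewrite lerXn2r ?nnegrE//; lra.
    have -> : (2 * (a * (a - 1) * l)) ^+ 2 = 2 * (a ^+ 2 * (a - 1) * l ^+ 2) * (2 * (a - 1)) by ring.
    have -> : 2 * (a ^+ 2 * (a - 1) * l ^+ 3) = 2 * (a ^+ 2 * (a - 1) * l ^+ 2) * l by ring.
    by rewrite ler_wpM2l ?mulr_ge0 ?exprn_ge0//; lra.
  - move: SE s_loR kR LR; clear; set S := sumsq _ _.
    set a := k%:R; set l := m.+1%:R => -> s_loR kR LR.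
    apply: le_trans s_loR.
    have v0 : 0 <= a * (a - 1) * l by rewrite mulr_ge0 ?mulr_ge0//; lra.
    have w0 : 0 <= a * l ^+ 2 by rewrite mulr_ge0 ?exprn_ge0//; lra.
    by have := mulr_ge0 v0 w0; lra.
apply: cos_prod_tail => //.
move: s_hiR kR k22R LR sR; clear; set a := k%:R; set l := m.+1%:R; set sg := s%:R.
move=> s_hiR kR k22R LR sR.
have v0 : 0 < a ^+ 2 * l ^+ 3 by rewrite mulr_gt0 ?exprn_gt0//; lra.
have h3 : sg ^+ 2 <= 4 * (a * l) ^+ 3.
  have : a ^+ 2 * l ^+ 3 * (a - 1) <= a ^+ 2 * l ^+ 3 * a by rewrite ler_pM2l//; lra.
  lra.
have h2 : sg <= (a * l) ^+ 2.
  apply: le_of_sqr_le; [lra|exact: sqr_ge0|apply: (le_trans s_hiR)].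
  have h : 4 * (a - 1) <= a ^+ 2 * l.
    apply: (@le_trans _ _ (a * (a * l))); last lra.
    have al : 4 <= a * l by nra.
    by nra.
  have := ler_wpM2l (ltW v0) h; lra.
have : sg * sg ^+ 2 <= (a * l) ^+ 2 * (4 * (a * l) ^+ 3).
  by apply: ler_pM => //; rewrite ?exprn_ge0// ltW.
lra.
Qed.

End Window.

(** * Monotonicity up to the centre and induction on [m] *)

(** The clause on the constant term is the increase from index [-1] to [0]; it is what
    multiplication by [1 + 'X^r] needs at [n = r]. *)
Definition ndecr_upto (h : nat) (p : {poly int}) :=
  0 <= p`_0 /\ forall n, (0 < n <= h)%N -> p`_n.-1 <= p`_n.

Lemma ndecr_upto_mul1DXn h p r : (0 < r)%N ->
  ndecr_upto h p -> ndecr_upto h (p * (1 + 'X^r)).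
Proof.
move=> r0 [p0 inc]; split; first by rewrite coef_mul1DXn r0 addr0.
move=> n hn; rewrite !coef_mul1DXn; apply: lerD; first exact: inc.
case: ltnP => h1; case: ltnP => h2 //; last 2 first.
- by lia.
- have -> : (n.-1 - r = (n - r).-1)%N by lia.
  by apply: inc; lia.
by have -> : (n - r = 0)%N by lia.
Qed.

Lemma ndecr_upto_prod h p (I : Type) (s : seq I) (f : I -> nat) :
  (forall i, (0 < f i)%N) -> ndecr_upto h p ->
  ndecr_upto h (p * \prod_(i <- s) (1 + 'X^(f i))).
Proof.
move=> f0; elim: s p => [|i s IH] p hp; first by rewrite big_nil mulr1.
by rewrite big_cons mulrA; apply/IH/ndecr_upto_mul1DXn.
Qed.

Lemma unimodal_DP k m : (0 < k)%N ->
  unimodal (D k m) <-> ndecr_upto (sumn (parts k m))./2 (D k m).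
Proof.
move=> k0; set N := sumn (parts k m).
have szD : (size (D k m)).-1 = N by rewrite size_D//= -sumn_parts mulKn.
have sym j : (j <= N)%N -> (D k m)`_(N - j) = (D k m)`_j.
  by rewrite D_parts; exact: distinct_gf_sym.
have D0 : 0 <= (D k m)`_0.
  rewrite D_parts /distinct_gf; elim: (parts k m) => [|r s IH].
    by rewrite big_nil coef1.
  rewrite big_cons mulrC coef_mul1DXn; case: ltnP => _; first by rewrite addr0.
  by rewrite sub0n addr_ge0.
rewrite /unimodal szD; split=> [[j [jN inc dec]]|[_ inc]].
  split=> // n /andP[n0 nh].
  have [nj|jn] := leqP n j; first by have := inc n.-1; rewrite prednK//; apply.
  (* The peak lies before [n], so the coefficients descend from [n] to [N - (n - 1)], the mirror
     image of [n - 1]. *)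
  rewrite -(sym n.-1); last lia.
  have mono i : (n + i <= N)%N -> (D k m)`_(n + i) <= (D k m)`_n.
    elim: i => [|i IH] h; first by rewrite addn0.
    by rewrite addnS; apply: le_trans (IH _); [apply: dec|]; lia.
  have -> : (N - n.-1 = n + (N - n.-1 - n))%N by lia.
  by apply: mono; lia.
exists N./2; split; first by lia.
- by move=> i ih; apply: (inc i.+1); lia.
- move=> i ih; rewrite -(sym i.+1); last lia.
  (* For odd [N] the two central coefficients are mirror images, hence equal. *)
  have [E|h] := eqVneq (N - i.+1)%N i; first by rewrite E.
  rewrite -(sym i); last lia.
  have -> : (N - i.+1 = (N - i).-1)%N by lia.
  by apply: inc; lia.
Qed.

Theorem theorem1p2 (R : realType) (k m0 : nat) (hk : (5 <= k)%N)
  (hm0 : unimodal (D k m0))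
  (hd : forall m : nat, (m0 < m)%N -> m%:R < 8 * (k%:R : R) `^ (3 / 2) ->
    forall n : nat,
      Num.ceil (k%:R * (k%:R - 1) * m%:R ^+ 2 / 4 : R) <= n%:Z
        <= Num.floor (k%:R * (k%:R - 1) * m.+1%:R ^+ 2 / 4 : R) ->
      d k m n.-1 <= d k m n) :
  forall m : nat, (m0 <= m)%N -> unimodal (D k m).
Proof.
have k0 : (0 < k)%N by lia.
have k1R : k%:R - 1 = k.-1%:R :> R by rewrite -subn1 natrB.
elim=> [|m IH] hm; first by move: hm hm0; rewrite leqn0 => /eqP ->.
have [<- //|m0m] := eqVneq m0 m.+1.
have /unimodal_DP -/(_ k0)[D0 incm] : unimodal (D k m) by apply: IH; lia.
apply/unimodal_DP => //.
(* Passing to [m + 1] multiplies by factors [1 + 'X^r] with [r > 0], which preserve monotonicity up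
   to the old centre. *)
have [D0' inc'] : ndecr_upto (sumn (parts k m))./2 (D k m.+1).
  rewrite /D big_nat_recr//=; apply: ndecr_upto_prod => //; lia.
split=> // n /andP[n0 nh].
have [nle|ngt] := leqP n (sumn (parts k m))./2; first by apply: inc'; rewrite n0.
have Nm := sumn_parts k m; have Nm1 := sumn_parts k m.+1.
have n_lo : (k * k.-1 * m.+1 ^ 2 <= 4 * n)%N by lia.
have n_hi : (4 * n <= k * k.-1 * m.+2 ^ 2)%N by lia.
(* Below the threshold the hypothesis applies; above it, squaring gives [64 k ^ 3 <= (m + 1) ^ 2],
   as the analytic estimate requires. *)
have [small|large] := ltP (m.+1%:R : R) (8 * k%:R `^ (3 / 2)).
  apply: (hd m.+1) => //; first by lia.
  rewrite ceil_le_int floor_ge_int -!pmulrn k1R.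
  rewrite ler_pdivrMr// ler_pdivlMr// -!natrX -!natrM !ler_nat.
  by rewrite [(n * 4)%N]mulnC n_lo n_hi.
apply: (@window_diff_large R) => //.
have sq : (k%:R `^ (3 / 2)) ^+ 2 = k%:R ^+ 3 :> R.
  rewrite -powR_mulrn ?powR_ge0// -powRrM -[RHS]powR_mulrn//; congr (_ `^ _); lra.
rewrite -(ler_nat R) natrM !natrX -sq.
have -> : 64 * (k%:R `^ (3 / 2)) ^+ 2 = (8 * k%:R `^ (3 / 2)) ^+ 2 :> R by ring.
by rewrite lerXn2r ?nnegrE ?mulr_ge0 ?powR_ge0.
Qed.
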